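(* Let $P:\mathbb{R}^n\to\mathbb{R}$ be a homogeneous real polynomial of degree $k$ that is symmetric and hyperbolic with respect to $\mathbf{1}=(1,\dots,1)$, and let $\Gamma(P)$ be its hyperbolicity cone with respect to $\mathbf{1}$. Then: (i) (Majorization closure) if $y\in\Gamma(P)$ and $x\in\mathbb{R}^n$ satisfies $x\prec y$, then $x\in\Gamma(P)$. (ii) (Schur-concavity) the map $f(x):=P(x)^{1/k}$ is Schur-concave on $\Gamma(P)$, i.e., if $x,y\in\Gamma(P)$ and $x\prec y$, then $P(x)^{1/k}\ge P(y)^{1/k}$. In particular, $P(x)\ge P(y)$.
   Context: A polynomial $P:\mathbb{R}^n\to\mathbb{R}$ is symmetric if $P(\sigma x)=P(x)$ for every permutation $\sigma$ of the coordinates and every $x\in\mathbb{R}^n$. A homogeneous real polynomial $P$ of degree $k$ on $\mathbb{R}^n$ is hyperbolic with respect to $a\in\mathbb{R}^n$ if $P(a)>0$ and, for every $x\in\mathbb{R}^n$, the univariate polynomial $t\mapsto P(ta+x)$ has only real zeros. In that case $P(ta+x)=P(a)\prod_{i=1}^k(t+\lambda_i(P;a,x))$ with real numbers $\lambda_i(P;a,x)$, called the $a$-eigenvalues of $x$. The hyperbolicity cone is $\Gamma(P;a)=\{x\in\mathbb{R}^n:\lambda_i(P;a,x)>0\text{ for all }i=1,\dots,k\}$, and $\Gamma(P):=\Gamma(P;\mathbf{1})$. Note that $P>0$ on $\Gamma(P)$; here $k\ge 1$, as is implicit in $P^{1/k}$. Majorization: for $x,y\in\mathbb{R}^n$, with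 $x^{\downarrow},y^{\downarrow}$ the nonincreasing rearrangements, $x\prec y$ means $\sum_{i=1}^j x_i^{\downarrow}\le\sum_{i=1}^j y_i^{\downarrow}$ for $j=1,\dots,n-1$, with equality for $j=n$. A real-valued function $\phi$ on a subset of $\mathbb{R}^n$ is Schur-concave if $x\prec y$ (with $x,y$ in the subset) implies $\phi(x)\ge\phi(y)$. *)

(* Defs.v *)
From mathcomp Require Import all_boot all_order all_algebra all_fingroup.
From mathcomp Require Import complex mpoly.
From mathcomp Require Import classical_sets reals exp.

Set Implicit Arguments.
Unset Strict Implicit.
Unset Printing Implicit Defensive.

Import Order.TTheory GRing.Theory Num.Theory.
Local Open Scope ring_scope.
Local Open Scope classical_set_scope.

Definition peval (R : realType) (n : nat) (P : {mpoly R[n]})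
    (x : 'rV[R]_n) : R :=
  P.@[fun i => x ord0 i].

Definition homogeneous (R : realType) (n k : nat) (P : {mpoly R[n]}) : Prop :=
  P \is k.-homog.

Definition symmetric_poly (R : realType) (n : nat) (P : {mpoly R[n]}) : Prop :=
  forall (s : 'S_n) (x : 'rV[R]_n), peval P (col_perm s x) = peval P x.

(* The univariate polynomial t |-> P (t a + x); see [horner_line_poly]. *)
Definition line_poly (R : realType) (n : nat) (P : {mpoly R[n]})
    (a x : 'rV[R]_n) : {poly R} :=
  mmap (@polyC R) (fun i => a ord0 i *: 'X + (x ord0 i)%:P) P.

Lemma horner_line_poly (R : realType) (n : nat) (P : {mpoly R[n]})
    (a x : 'rV[R]_n) (t : R) :
  (line_poly P a x).[t] = peval P (t *: a + x).
Proof.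
rewrite /line_poly /peval /meval /mmap horner_sum.
apply: eq_bigr => m _; rewrite hornerM hornerC /mmap1 horner_prod.
by congr (_ * _); apply: eq_bigr => i _; rewrite !hornerE !mxE mulrC.
Qed.

(* The zeros are sought in the complex numbers R[i].  The zero polynomial does
   not qualify, but P (t a + x) has degree k in t when P (a) != 0. *)
Definition only_real_zeros (R : realType) (p : {poly R}) : Prop :=
  forall z : R[i], root (map_poly (real_complex R) p) z -> complex.Im z = 0.

Definition hyperbolic (R : realType) (n k : nat) (P : {mpoly R[n]})
    (a : 'rV[R]_n) : Prop :=
  [/\ homogeneous k P, 0 < peval P a
    & forall x : 'rV[R]_n, only_real_zeros (line_poly P a x)].

(* [l] lists the a-eigenvalues of [x] with multiplicity; for hyperbolic [P] it
   exists and is unique up to the order of its entries. *)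
Definition eigenvalues (R : realType) (n k : nat) (P : {mpoly R[n]})
    (a x : 'rV[R]_n) (l : k.-tuple R) : Prop :=
  forall t : R, peval P (t *: a + x) = peval P a * \prod_(i < k) (t + tnth l i).

Definition hyperbolicity_cone (R : realType) (n k : nat) (P : {mpoly R[n]})
    (a : 'rV[R]_n) : set 'rV[R]_n :=
  [set x | exists l : k.-tuple R,
     eigenvalues P a x l /\ forall i : 'I_k, 0 < tnth l i].

Definition decreasing_rearrangement (R : realType) (n : nat) (x : 'rV[R]_n) :
    seq R :=
  sort (fun u v : R => v <= u) [seq x ord0 i | i : 'I_n].

Definition sum_largest (R : realType) (n : nat) (x : 'rV[R]_n) (j : nat) : R :=
  \sum_(0 <= i < j) nth 0 (decreasing_rearrangement x) i.

Definition majorized (R : realType) (n : nat) (x y : 'rV[R]_n) : Prop :=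
  (forall j : nat, (0 < j < n)%N -> sum_largest x j <= sum_largest y j) /\
  sum_largest x n = sum_largest y n.

Definition schur_concave (R : realType) (n : nat) (D : set 'rV[R]_n)
    (phi : 'rV[R]_n -> R) : Prop :=
  forall x y : 'rV[R]_n, D x -> D y -> majorized x y -> phi y <= phi x.

(* Main.v *)
Require Import Defs.
From mathcomp Require Import all_boot all_order all_algebra all_fingroup.
From mathcomp Require Import complex ring lra zify.
From mathcomp Require Import boolp classical_sets reals exp.
From mathcomp Require Import -(notations) mpoly.
Import Order.TTheory GRing.Theory Num.Theory.
Local Open Scope ring_scope.

Set Implicit Arguments.
Unset Strict Implicit.
Unset Printing Implicit Defensive.

(** The heart of the matter is that the hyperbolicity cone is convex, and that
    hyperbolicity with respect to the all-one vector passes to every direction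
    of the cone (Garding).  Say that [u] is nonvanishing when [P (x + i u)] is
    nonzero for every real [x]; for homogeneous [P] this is hyperbolicity in
    the direction [u], up to sign.  Let [y] be in the cone and let [1 + e u] be
    nonvanishing for [0 <= e <= 1].  The roots in [w] of
    [P (i 1 + e (x + i u) + w y)] are never real, they are [k] in number for
    every [e] since the leading coefficient [P y] does not move, and for
    [e = 0] they are the [- i / lambda_j], where the [lambda_j > 0] are the
    eigenvalues of [y].  So they stay in the lower half-plane up to [e = 1]
    ([half_plane_homotopy]), which says that [1 + u + b y] is nonvanishing for
    all [b >= 0] ([nonvanishing_extend]).  Two uses of this step give all
    [1 + a y + b y'] with [y] and [y'] in the cone, and the convexity follows
    because the cone is open in the direction [1] ([cone_convex]).

    Now let [y' = s y] for an involutive permutation [s] of the coordinates,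
    and let [m] and [d] be the half sum and the half difference of [y] and
    [y'].  The polynomial [g t = P (m + t d)] is even by symmetry; its zeros
    are real since [m] is nonvanishing, and they lie outside [-1, 1] since the
    segment from [y'] to [y] is in the cone.  With zeros [r_j],
    [g t ^ 2 = g t * g (- t)] is a constant times the product of the
    [r_j ^ 2 - t ^ 2], which is largest at [t = 0] and smallest at
    [t = 1] and [t = -1], that is, at [y] and [y']
    ([even_real_rooted_decreasing], [averaging_increases]).

    Finally, [x] is majorized by [y] only if [x] is reached from [y] by
    permutations and by averagings of a point with its image under a
    transposition ([majorized_induction], after Hardy, Littlewood and Polya).
    Each of these keeps the point in the cone and does not decrease [P]. *)

(** * A moving polynomial keeps its roots in the lower half-plane *)

Section RootHomotopy.
Context {R : realType}.
Implicit Types (e a b : R) (w z : R[i]) (rs : seq R[i]).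

Local Notation normc := ComplexField.Normc.normc.
Local Notation Re := complex.Re.
Local Notation Im := complex.Im.

Lemma normc_ge0 z : 0 <= normc z.
Proof. by case: z => x y /=; exact: sqrtr_ge0. Qed.

Lemma normc_ge_Im z : `|Im z| <= normc z.
Proof.
case: z => x y /=; rewrite -sqrtr_sqr ler_sqrt ?addr_ge0 ?sqr_ge0 //.
by rewrite lerDr sqr_ge0.
Qed.

Lemma normc_prod rs w :
  normc (\prod_(z <- rs) (w - z)) = \prod_(z <- rs) normc (w - z).
Proof.
elim: rs => [|z rs IH]; first by rewrite !big_nil ComplexField.Normc.normc1.
by rewrite !big_cons ComplexField.Normc.normcM IH.
Qed.

(** A predicate that is locally constant on the unit interval is constant there:
    the supremum of the initial segments where it holds can be pushed further
    unless it is 1. *)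
Lemma unit_interval_propagation (G : R -> Prop) :
  G 0 ->
  (forall a, 0 <= a <= 1 -> exists2 d, 0 < d &
     forall b, 0 <= b <= 1 -> `|b - a| < d -> (G a <-> G b)) ->
  G 1.
Proof.
move=> G0 Gloc.
pose A : set R := [set t | 0 <= t <= 1 /\ forall s, 0 <= s <= t -> G s]%classic.
have A0 : A 0.
  split=> [|s]; first by rewrite lexx ler01.
  by rewrite -eq_le => /eqP <-.
have ubA : ubound A 1 by move=> t [/andP[]].
have supA : has_sup A by split; [exists 0 | exists 1].
have s0 : 0 <= sup A by apply: (sup_upper_bound supA).
have s1 : sup A <= 1 by apply: ge_sup => //; exists 0.
have [|d d0 Gd] := Gloc (sup A); first by rewrite s0 s1.
have [t [/andP[t0 t1] At] lt] := sup_adherent d0 supA.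
have ts : t <= sup A by apply: (sup_upper_bound supA); split => //; rewrite t0 t1.
have Gt : G t by apply: At; rewrite t0 lexx.
have Gs : G (sup A).
  by apply/(Gd t); [rewrite t0 t1 | rewrite ltr_norml; lra |].
pose u := Num.min 1 (sup A + d / 2).
have Au : A u.
  have u1 : u <= 1 by rewrite ge_min lexx.
  have u2 : u <= sup A + d / 2 by rewrite ge_min lexx orbT.
  split; first by rewrite u1 andbT le_min ler01 /=; lra.
  move=> s /andP[s_ge0 su]; have [st|ts'] := leP s t; first by apply: At; rewrite s_ge0.
  apply/(Gd s) => //; first by lra.
  by rewrite ltr_norml; lra.
have : u <= sup A by apply: (sup_upper_bound supA).
rewrite ge_min => /orP[h|]; last by lra.
by rewrite (_ : 1 = sup A) //; apply/le_anti; rewrite h s1.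
Qed.

(** For [Im z < 0 <= Im w], the distance [|w - z|] is at least [- Im z], hence
    at least a fixed multiple of [1 + |w|].  Having the full power of
    [1 + |w|] makes the bound uniform on an unbounded region, so that no
    bound on the roots of nearby polynomials is required. *)
Lemma prod_lower_bound rs :
  (forall z, z \in rs -> Im z < 0) ->
  exists2 K, 0 < K & forall w, 0 <= Im w ->
    K * (1 + normc w) ^+ size rs <= normc (\prod_(z <- rs) (w - z)).
Proof.
elim: rs => [|z rs IH] hrs.
  exists 1 => // w _; rewrite big_nil expr0 mulr1.
  by rewrite ComplexField.Normc.normc1.
have [|K K0 hK] := IH; first by move=> x xrs; apply: hrs; rewrite inE xrs orbT.
have hz : Im z < 0 by apply: hrs; rewrite inE eqxx.
pose L := (1 + normc z) / - Im z + 1.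
have nz := normc_ge0 z.
have q0 : 0 <= (1 + normc z) / - Im z by rewrite divr_ge0 //; lra.
have L0 : 0 < L by rewrite /L; lra.
exists (L^-1 * K) => [|w w0]; first by rewrite mulr_gt0 // invr_gt0.
rewrite /= exprS big_cons ComplexField.Normc.normcM mulrACA.
apply: ler_pM.
- by rewrite mulr_ge0 ?invr_ge0 ?(ltW L0) // addr_ge0 // normc_ge0.
- by rewrite mulr_ge0 ?(ltW K0) // exprn_ge0 // addr_ge0 // normc_ge0.
- rewrite mulrC ler_pdivrMr //.
  have tri : normc w <= normc (w - z) + normc z.
    by rewrite -{1}(subrK z w); exact: le_normcD.
  have him : - Im z <= normc (w - z).
    apply: le_trans (normc_ge_Im _); apply: le_trans (ler_norm _).
    by case: (w) w0 => ? ?; case: (z) => ? ? /=; lra.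
  have : 1 + normc z <= normc (w - z) * ((1 + normc z) / - Im z).
    rewrite mulrA ler_pdivlMr; last by lra.
    by rewrite [leRHS]mulrC; apply: ler_wpM2l => //; lra.
  rewrite /L mulrDr mulr1; lra.
- exact: hK.
Qed.

(** Both having a root above the real axis and having none are stable under a
    small change of the parameter.  If [F a] has a root [w0] there and all
    roots of [F b] lay below the axis, then [F b w0] would be at least
    [|c| (Im w0) ^ k].  If [F a] has no root above, [prod_lower_bound] beats the
    Lipschitz estimate.  As the two situations are complementary when no root is
    real, [unit_interval_propagation] applies. *)
Lemma half_plane_homotopy (k : nat) (c : R[i]) (F : R -> R[i] -> R[i]) :
  c != 0 ->
  (forall e, exists2 rs, size rs = k &
     forall w, F e w = c * \prod_(z <- rs) (w - z)) ->
  (exists2 M, 0 <= M & forall a b w, 0 <= a <= 1 -> 0 <= b <= 1 ->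
     normc (F b w - F a w) <= M * `|b - a| * (1 + normc w) ^+ k) ->
  (forall e w, 0 <= e <= 1 -> F e w = 0 -> Im w != 0) ->
  (forall w, F 0 w = 0 -> Im w < 0) ->
  forall w, F 1 w = 0 -> Im w < 0.
Proof.
move=> c0 Ffac [M M0 FLip] Freal F0.
have nc0 : 0 < normc c.
  rewrite lt_neqAle normc_ge0 andbT eq_sym; apply: contra c0 => /eqP h.
  by rewrite (ComplexField.Normc.eq0_normc h).
have M1 : 0 < M + 1 by lra.
have MM a d : d / (M + 1) > `|a| -> M * `|a| < d.
  rewrite ltr_pdivlMr; last by lra.
  by have := normr_ge0 a; nra.
apply: (@unit_interval_propagation (fun e => forall w, F e w = 0 -> Im w < 0) F0 _)
  => a a01.
have [rs szrs Frs] := Ffac a.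
(* Either [F a] already has a root above the axis, and then so does [F b]. *)
have [[w0 [Fw0 w0_ge0]]|noUp] := pselect (exists w, F a w = 0 /\ 0 <= Im w).
  have w0_gt0 : 0 < Im w0.
    by rewrite lt_neqAle w0_ge0 andbT eq_sym; exact: (Freal a).
  pose B := (1 + normc w0) ^+ k.
  have B0 : 0 < B by rewrite exprn_gt0 // ltr_pwDl // normc_ge0.
  exists (normc c * Im w0 ^+ k / B / (M + 1)).
    by rewrite !divr_gt0 ?mulr_gt0 ?exprn_gt0 // ltr_pwDl // normc_ge0.
  move=> b b01 /MM hb; split=> [/(_ _ Fw0)|hGb]; first by lra.
  have [rs' szrs' Frs'] := Ffac b.
  have := FLip a b w0 a01 b01; rewrite Fw0 subr0 Frs'
    ComplexField.Normc.normcM normc_prod.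
  suff : normc c * Im w0 ^+ k <= normc c * \prod_(z <- rs') normc (w0 - z).
    rewrite -/B => h1 h2; move: hb; rewrite ltr_pdivlMr // => hb.
    by have := le_lt_trans (le_trans h1 h2) hb; rewrite ltxx.
  rewrite ler_pM2l // -szrs'.
  have : forall z, z \in rs' -> Im z < 0.
    move=> z zrs; apply: hGb; rewrite Frs' (big_rem z) //=.
    by rewrite subrr mul0r mulr0.
  elim: (rs') => [|z s IH] hs; first by rewrite expr0 big_nil.
  rewrite /= exprS big_cons; apply: ler_pM => //; first by rewrite exprn_ge0.
    apply: le_trans (normc_ge_Im _); apply: le_trans (ler_norm _).
    have : Im z < 0 by apply: hs; rewrite inE eqxx.
    by case: (w0) => ? ?; case: (z) => ? ? /=; lra.
  by apply: IH => x xs; apply: hs; rewrite inE xs orbT.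
(* Or all roots of [F a] are below the axis, and then so are those of [F b]. *)
have Gall z : F a z = 0 -> Im z < 0.
  by move=> Fz; rewrite ltNge; apply/negP => h; apply: noUp; exists z.
have [|K K0 hK] := @prod_lower_bound rs.
  move=> z zrs; apply: Gall; rewrite Frs (big_rem z) //=.
  by rewrite subrr mul0r mulr0.
exists (normc c * K / (M + 1)).
  by rewrite divr_gt0 ?mulr_gt0.
move=> b b01 /MM hb; split=> // _ w Fw; rewrite ltNge; apply/negP => w_ge0.
have := FLip a b w a01 b01; rewrite Fw sub0r normcN Frs ComplexField.Normc.normcM.
have := hK w w_ge0; rewrite szrs -(ler_pM2l nc0) mulrA => h1 h2.
have := le_trans h1 h2; rewrite ler_pM2r; first by lra.
by rewrite exprn_gt0 // ltr_pwDl // normc_ge0.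
Qed.

End RootHomotopy.

(** * Evaluation at complex vectors *)

Section ComplexEvaluation.
Context {R : realType} {n k : nat}.
Implicit Types (P : mpoly n R) (u x y : 'rV[R]_n) (c v : 'I_n -> R[i]).

Local Notation normc := ComplexField.Normc.normc.
Local Notation Re := complex.Re.
Local Notation Im := complex.Im.
Local Notation toC := (real_complex R).

Definition ceval P v : R[i] := mmap toC v P.

Lemma eq_ceval P v v' : v =1 v' -> ceval P v = ceval P v'.
Proof.
by move=> vv'; apply: eq_bigr => m _; congr (_ * _); exact: mmap1_eq.
Qed.

Lemma ceval_real P x : ceval P (fun i => toC (x ord0 i)) = toC (peval P x).
Proof.
rewrite /ceval /peval /meval /mmap rmorph_sum; apply: eq_bigr => m _.
rewrite rmorphM; congr (_ * _); rewrite /mmap1 rmorph_prod.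
by apply: eq_bigr => i _; rewrite rmorphXn.
Qed.

Lemma horner_map_line_poly P a x (z : R[i]) :
  (map_poly toC (line_poly P a x)).[z] =
  ceval P (fun i => toC (x ord0 i) + z * toC (a ord0 i)).
Proof.
rewrite /line_poly /ceval /mmap rmorph_sum horner_sum; apply: eq_bigr => m _.
rewrite rmorphM /= map_polyC hornerM hornerC; congr (_ * _).
rewrite /mmap1 rmorph_prod horner_prod; apply: eq_bigr => i _.
rewrite rmorphXn horner_exp rmorphD /= map_polyZ map_polyX map_polyC.
by rewrite hornerD hornerZ hornerX hornerC addrC mulrC.
Qed.

Lemma homogeneousE P m : homogeneous k P -> m \in msupp P -> mdeg m = k.
Proof. by move=> /dhomogP h /h. Qed.

Lemma cevalZ P v (a : R[i]) : homogeneous k P ->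
  ceval P (fun i => a * v i) = a ^+ k * ceval P v.
Proof.
move=> hP; rewrite /ceval /mmap mulr_sumr !big_seq; apply: eq_bigr => m mP.
rewrite [RHS]mulrCA; congr (_ * _).
rewrite -(homogeneousE hP mP) mdegE -prodrXr -big_split /=.
by apply: eq_bigr => i _; rewrite exprMn.
Qed.

(** The degree is only bounded above, so that the coefficient may vanish: this
    keeps the relation stable under products and sums. *)
Definition top_coef (d : nat) (a : R[i]) (p : {poly R[i]}) :=
  (size p <= d.+1)%N /\ p`_d = a.

Lemma top_coefM d e a b p q :
  top_coef d a p -> top_coef e b q -> top_coef (d + e) (a * b) (p * q).
Proof.
move=> [sp <-] [sq <-]; split.
  apply: leq_trans (size_polyMleq _ _) _.
  by have := leq_add sp sq; lia.
rewrite coefM (bigD1 (Ordinal (leq_addr e d : (d < (d + e).+1)%N))) //=.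
rewrite addKn big1 ?addr0 // => i; rewrite -val_eqE /= => ni.
have [id|di] := ltnP i d; last first.
  by rewrite nth_default ?mul0r // (leq_trans sp) // ltn_neqAle eq_sym ni.
rewrite [q`__]nth_default ?mulr0 // (leq_trans sq) //.
by have := ltn_ord i; lia.
Qed.

Lemma top_coefX d a p m : top_coef d a p -> top_coef (m * d) (a ^+ m) (p ^+ m).
Proof.
move=> h; elim: m => [|m IH].
  by split; rewrite expr0 ?size_poly1 // coef1.
by rewrite !exprS mulSn; exact: top_coefM.
Qed.

Lemma top_coef_prod (I : Type) (r : seq I) (d : I -> nat) a p :
  (forall i, top_coef (d i) (a i) (p i)) ->
  top_coef (\sum_(i <- r) d i) (\prod_(i <- r) a i) (\prod_(i <- r) p i).
Proof.
move=> h; elim: r => [|i r IH].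
  by rewrite !big_nil; split; rewrite ?size_poly1 // coef1.
by rewrite !big_cons; exact: top_coefM.
Qed.

Lemma top_coef_linear (a b : R[i]) : top_coef 1 a (a *: 'X + b%:P).
Proof.
split; last by rewrite coefD coefZ coefX coefC mulr1 addr0.
apply: leq_trans (size_polyD _ _) _.
by rewrite geq_max (leq_trans (size_scale_leq _ _)) ?size_polyX //
  size_polyC ltnW // ltnS leq_b1.
Qed.

(** In the variable [w], the coefficient of [w ^ k] in [P (c + w y)] is [P y],
    independently of [c]. *)
Lemma ceval_factor P c y : homogeneous k P -> peval P y != 0 ->
  exists2 rs : seq R[i], size rs = k & forall w,
    ceval P (fun i => c i + w * toC (y ord0 i)) =
    toC (peval P y) * \prod_(z <- rs) (w - z).
Proof.
move=> hP Py.
pose q := mmap (@polyC R[i] \o toC)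
  (fun i => toC (y ord0 i) *: 'X + (c i)%:P) P.
have qE w : q.[w] = ceval P (fun i => c i + w * toC (y ord0 i)).
  rewrite /q /ceval /mmap horner_sum; apply: eq_bigr => m _.
  rewrite hornerM hornerC; congr (_ * _); rewrite /mmap1 horner_prod.
  by apply: eq_bigr => i _; rewrite horner_exp !hornerE addrC mulrC.
have [szq qk] : top_coef k (toC (peval P y)) q.
  rewrite -ceval_real /q /ceval /mmap !big_seq.
  apply: (big_ind2 (top_coef k)) => [|p a p' a' [h <-] [h' <-]|m mP].
  - by split; rewrite ?size_poly0 ?coef0.
  - by split; rewrite ?coefD // (leq_trans (size_polyD _ _)) // geq_max h.
  - rewrite -[k]add0n -(homogeneousE hP mP) mdegE; apply: top_coefM.
      by split; rewrite ?size_polyC ?leq_b1 // coefC.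
    apply: top_coef_prod => i; rewrite -[m i]muln1.
    by rewrite muln1 -[X in top_coef X]muln1; exact/top_coefX/top_coef_linear.
have c0 : toC (peval P y) != 0 by rewrite fmorph_eq0.
have szq' : size q = k.+1.
  apply/eqP; rewrite eqn_leq szq /= ltnNge; apply/negP => h.
  by move: c0; rewrite -qk nth_default ?eqxx.
have [rs qrs] := closed_field_poly_normal q.
have lq : lead_coef q = toC (peval P y) by rewrite lead_coefE szq'.
exists rs.
  have := congr1 (fun p : {poly _} => size p) qrs.
  by rewrite size_scale ?lq // size_prod_XsubC szq' => -[].
move=> w; rewrite -qE qrs lq hornerZ horner_prod; congr (_ * _).
by apply: eq_bigr => z _; rewrite hornerXsubC.
Qed.

End ComplexEvaluation.

(** * Continuity of a homogeneous polynomial along a segment *)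

Section LipschitzFamily.
Context {R : realType}.
Implicit Types (f g : R -> R[i] -> R[i]) (a b : R) (w z : R[i]).

Local Notation normc := ComplexField.Normc.normc.
Local Notation toC := (real_complex R).

(** The factor [(1 + |w|) ^ d] makes the estimates multiplicative in [d], and
    is the one with which [prod_lower_bound] is compared. *)
Definition lipschitz_growth (d : nat) f :=
  exists M : R, [/\ 0 <= M,
    forall a w, 0 <= a <= 1 -> normc (f a w) <= M * (1 + normc w) ^+ d
  & forall a b w, 0 <= a <= 1 -> 0 <= b <= 1 ->
      normc (f b w - f a w) <= M * `|b - a| * (1 + normc w) ^+ d].

Let growth_ge0 d w : 0 <= (1 + normc w) ^+ d.
Proof. by rewrite exprn_ge0 // addr_ge0 // normc_ge0. Qed.

Lemma lipschitz_growth_cst z : lipschitz_growth 0 (fun _ _ => z).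
Proof.
exists (normc z); split=> [|a w _|a b w _ _]; first exact: normc_ge0.
  by rewrite expr0 mulr1.
by rewrite subrr ComplexField.Normc.normc0 expr0 mulr1 mulr_ge0 ?normc_ge0.
Qed.

Lemma lipschitz_growthD d f g : lipschitz_growth d f -> lipschitz_growth d g ->
  lipschitz_growth d (fun a w => f a w + g a w).
Proof.
move=> [M [M0 fB fL]] [N [N0 gB gL]]; exists (M + N); split=> [|a w a01|a b w a01 b01].
- exact: addr_ge0.
- by apply: le_trans (le_normcD _ _) _; rewrite mulrDl lerD ?fB ?gB.
- rewrite opprD addrACA; apply: le_trans (le_normcD _ _) _.
  by rewrite !mulrDl lerD ?fL ?gL.
Qed.

(** The constant [2 M N] also absorbs the two terms of the telescoped difference
    [f_b (g_b - g_a) + (f_b - f_a) g_a]. *)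
Lemma lipschitz_growthM d e f g :
  lipschitz_growth d f -> lipschitz_growth e g ->
  lipschitz_growth (d + e) (fun a w => f a w * g a w).
Proof.
move=> [M [M0 fB fL]] [N [N0 gB gL]]; exists (2 * M * N).
split=> [|a w a01|a b w a01 b01].
- by rewrite !mulr_ge0.
- rewrite ComplexField.Normc.normcM.
  apply: (@le_trans _ _ (M * (1 + normc w) ^+ d * (N * (1 + normc w) ^+ e))).
    by apply: ler_pM; rewrite ?normc_ge0 ?fB ?gB.
  rewrite mulrACA -exprD ler_wpM2r //.
  by have := mulr_ge0 M0 N0; lra.
- rewrite (_ : _ - _ = f b w * (g b w - g a w) + (f b w - f a w) * g a w); last by ring.
  apply: le_trans (le_normcD _ _) _; rewrite !ComplexField.Normc.normcM.
  have h1 : normc (f b w) * normc (g b w - g a w) <=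
      M * (1 + normc w) ^+ d * (N * `|b - a| * (1 + normc w) ^+ e).
    by apply: ler_pM; rewrite ?normc_ge0 ?fB ?gL.
  have h2 : normc (f b w - f a w) * normc (g a w) <=
      M * `|b - a| * (1 + normc w) ^+ d * (N * (1 + normc w) ^+ e).
    by apply: ler_pM; rewrite ?normc_ge0 ?gB ?fL.
  apply: le_trans (lerD h1 h2) _; rewrite exprD le_eqVlt; apply/orP; left.
  by apply/eqP; ring.
Qed.

Lemma lipschitz_growthX d f m : lipschitz_growth d f ->
  lipschitz_growth (m * d) (fun a w => f a w ^+ m).
Proof.
move=> fd; elim: m => [|m IH]; first exact: (lipschitz_growth_cst 1).
rewrite mulSn [X in lipschitz_growth _ X](_ : _ = fun a w => f a w * f a w ^+ m).
  exact: lipschitz_growthM.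
by apply/funext => a; apply/funext => w; rewrite exprS.
Qed.

Lemma lipschitz_growth_sum d (I : eqType) (r : seq I) (F : I -> R -> R[i] -> R[i]) :
  (forall i, i \in r -> lipschitz_growth d (F i)) ->
  lipschitz_growth d (fun a w => \sum_(i <- r) F i a w).
Proof.
elim: r => [|i r IH] hF.
  rewrite [X in lipschitz_growth _ X](_ : _ = fun _ _ => 0).
    exists 0; split=> // [a w _|a b w _ _].
      by rewrite ComplexField.Normc.normc0 mul0r.
    by rewrite subrr ComplexField.Normc.normc0 !mul0r.
  by apply/funext => a; apply/funext => w; rewrite big_nil.
rewrite [X in lipschitz_growth _ X](_ : _ =
  fun a w => F i a w + \sum_(i <- r) F i a w).
  apply: lipschitz_growthD; first by apply: hF; rewrite inE eqxx.
  by apply: IH => j jr; apply: hF; rewrite inE jr orbT.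
by apply/funext => a; apply/funext => w; rewrite big_cons.
Qed.

Lemma lipschitz_growth_prod (I : Type) (r : seq I) (d : I -> nat)
    (F : I -> R -> R[i] -> R[i]) :
  (forall i, lipschitz_growth (d i) (F i)) ->
  lipschitz_growth (\sum_(i <- r) d i) (fun a w => \prod_(i <- r) F i a w).
Proof.
move=> hF; elim: r => [|i r IH].
  rewrite big_nil [X in lipschitz_growth _ X](_ : _ = fun _ _ => 1).
    exact: lipschitz_growth_cst.
  by apply/funext => a; apply/funext => w; rewrite big_nil.
rewrite big_cons [X in lipschitz_growth _ X](_ : _ =
  fun a w => F i a w * \prod_(i <- r) F i a w).
  exact: lipschitz_growthM.
by apply/funext => a; apply/funext => w; rewrite big_cons.
Qed.

Lemma lipschitz_growth_linear (c0 c1 z : R[i]) :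
  lipschitz_growth 1 (fun a w => c0 + toC a * c1 + w * z).
Proof.
have N0 := normc_ge0 c0; have N1 := normc_ge0 c1; have Nz := normc_ge0 z.
have normr a : normc (toC a) = `|a|.
  by rewrite /= expr0n /= addr0 sqrtr_sqr.
exists (normc c0 + normc c1 + normc z).
split=> [|a w /andP[a0 a1]|a b w a01 b01].
- by rewrite !addr_ge0.
- have Nw := normc_ge0 w; rewrite expr1.
  have h1 := le_normcD (c0 + toC a * c1) (w * z).
  have h2 := le_normcD c0 (toC a * c1).
  move: h1 h2; rewrite !ComplexField.Normc.normcM normr ger0_norm //.
  nra.
- rewrite opprD addrACA subrr addr0 opprD addrACA subrr add0r -mulrBl -rmorphB.
  rewrite ComplexField.Normc.normcM normr expr1 [leLHS]mulrC.
  have Nw := normc_ge0 w; have Nba := normr_ge0 (b - a).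
  rewrite -[leLHS]mulr1; apply: ler_pM; rewrite ?mulr_ge0 //; last by lra.
  by apply: ler_wpM2r => //; lra.
Qed.

Lemma ceval_lipschitz (n k : nat) (P : mpoly n R) (c0 c1 : 'I_n -> R[i])
    (y : 'rV[R]_n) : homogeneous k P ->
  lipschitz_growth k (fun a w =>
    ceval P (fun i => c0 i + toC a * c1 i + w * toC (y ord0 i))).
Proof.
move=> hP; rewrite /ceval /mmap; apply: lipschitz_growth_sum => m mP.
rewrite -[k]add0n; apply: lipschitz_growthM; first exact: lipschitz_growth_cst.
rewrite -(homogeneousE hP mP) mdegE; apply: lipschitz_growth_prod => i.
by rewrite -[X in lipschitz_growth X]muln1;
  exact/lipschitz_growthX/lipschitz_growth_linear.
Qed.

End LipschitzFamily.

(** * Convexity of the hyperbolicity cone *)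

Section HyperbolicityCone.
Context {R : realType} {n k : nat} (P : mpoly n R).
Context (P_hyp : hyperbolic k P (const_mx 1)).
Implicit Types (u x y : 'rV[R]_n) (a b e t : R) (w z : R[i]).

Local Notation Re := complex.Re.
Local Notation Im := complex.Im.
Local Notation toC := (real_complex R).
Local Notation one := (const_mx 1 : 'rV[R]_n).
Local Notation cone := (hyperbolicity_cone k P one).
Local Notation iC := (Complex 0 1 : R[i]).

Let P_homog : homogeneous k P. Proof. by case: P_hyp. Qed.
Let P1_gt0 : 0 < peval P one. Proof. by case: P_hyp. Qed.

(** For homogeneous [P] this is real-rootedness of [t |-> P (t u + x)] for all
    [x]: a zero [p + i q] with [q] nonzero gives, after division by [q], a zero
    [x' + i u] of [P] with [x'] real. *)
Definition nonvanishing u :=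
  forall x, ceval P (fun i => Complex (x ord0 i) (u ord0 i)) != 0.

Lemma line_root_real x z :
  ceval P (fun i => toC (x ord0 i) + z * toC (one ord0 i)) = 0 -> Im z = 0.
Proof.
move=> h; case: P_hyp => _ _ /(_ x); apply.
by rewrite /root horner_map_line_poly h.
Qed.

Lemma complex_scale a z : toC a * z = Complex (a * Re z) (a * Im z).
Proof. by case: z => x y; simpc. Qed.

Lemma nonvanishing_one : nonvanishing one.
Proof.
move=> x; apply/eqP => h; suff : Im iC = 0 by move/eqP; rewrite /= oner_eq0.
apply: (@line_root_real x); rewrite -[RHS]h; apply: eq_ceval => i.
by rewrite mulrC complex_scale mxE /=; simpc.
Qed.

Lemma nonvanishingZ a u : a != 0 -> nonvanishing u -> nonvanishing (a *: u).
Proof.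
move=> a0 hu x.
rewrite (@eq_ceval _ _ _ _ (fun i =>
    toC a * Complex ((a^-1 *: x) ord0 i) (u ord0 i))) => [|i].
  by rewrite (cevalZ _ _ P_homog) mulf_neq0 // expf_neq0 // fmorph_eq0.
by rewrite complex_scale /= !mxE mulrA divff ?mul1r.
Qed.

Lemma nonvanishing_peval u : nonvanishing u -> peval P u != 0.
Proof.
move=> /(_ 0); rewrite (@eq_ceval _ _ _ _ (fun i => iC * toC (u ord0 i))).
  by rewrite (cevalZ _ _ P_homog) ceval_real mulf_eq0 negb_or fmorph_eq0 => /andP[].
by move=> i; rewrite mulrC complex_scale mxE /= mulr0 mulr1.
Qed.

Lemma peval_cone_gt0 y : cone y -> 0 < peval P y.
Proof.
move=> [l [hl lpos]]; have := hl 0; rewrite scale0r add0r => ->.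
by rewrite mulr_gt0 // prodr_gt0 // => i _; rewrite add0r.
Qed.

(** The factorization defining the eigenvalues holds for real [t], hence as an
    identity of polynomials, hence at every complex number. *)
Lemma ceval_eigenvalues y (l : k.-tuple R) z : eigenvalues P one y l ->
  ceval P (fun i => toC (y ord0 i) + z * toC (one ord0 i)) =
  toC (peval P one) * \prod_(i < k) (z + toC (tnth l i)).
Proof.
move=> hl.
have E : line_poly P one y = peval P one *: \prod_(i < k) ('X + (tnth l i)%:P).
  apply/eqP; rewrite -subr_eq0; apply/eqP; set p := (X in X = 0).
  have pt t : p.[t] = 0.
    rewrite /p !hornerE horner_line_poly hl horner_prod; apply/eqP.
    by rewrite subr_eq0; apply/eqP; congr (_ * _);
      apply: eq_bigr => i _; rewrite !hornerE.
  apply: (@roots_geq_poly_eq0 _ p [seq i%:R | i <- iota 0 (size p)]).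
  - by apply/allP => t _; rewrite /root pt.
  - by rewrite map_inj_uniq ?iota_uniq //; exact: (mulrIn (oner_neq0 R)).
  - by rewrite size_map size_iota.
rewrite -horner_map_line_poly E map_polyZ hornerZ; congr (_ * _).
rewrite rmorph_prod horner_prod; apply: eq_bigr => i _.
by rewrite rmorphD /= map_polyX map_polyC !hornerE.
Qed.

(** By homogeneity the roots are the [- i / lambda_j], where the [lambda_j] are
    the eigenvalues of [y]. *)
Lemma cone_lower_roots y w : cone y ->
  ceval P (fun i => iC + w * toC (y ord0 i)) = 0 -> Im w < 0.
Proof.
move=> [l [hl lpos]].
have I0 : iC != 0 by rewrite eq_complex /= oner_eq0 andbF.
have [->|w0] := eqVneq w 0.
  rewrite (@eq_ceval _ _ _ _ (fun i => iC * toC (one ord0 i))).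
    move/eqP; rewrite (cevalZ _ _ P_homog) ceval_real mulf_eq0 expf_eq0
      (negbTE I0) andbF /=.
    by rewrite fmorph_eq0 gt_eqF.
  by move=> i; rewrite mul0r addr0 mxE rmorph1 mulr1.
rewrite (@eq_ceval _ _ _ _ (fun i =>
    w * (toC (y ord0 i) + (iC / w) * toC (one ord0 i)))).
  rewrite (cevalZ _ _ P_homog) (ceval_eigenvalues _ hl) => /eqP.
  rewrite !mulf_eq0 expf_eq0 (negbTE w0) andbF fmorph_eq0 gt_eqF //=.
  move=> /prodf_eq0[i _]; rewrite addr_eq0 => /eqP h.
  have {h} : iC = - toC (tnth l i) * w by rewrite -h divfK.
  rewrite mulNr complex_scale => -[_ /eqP]; rewrite eq_sym eqr_oppLR => /eqP h.
  by rewrite -(pmulr_rlt0 _ (lpos i)) h; lra.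
by move=> i; rewrite mxE rmorph1 mulr1 mulrDr [w * (iC / w)]mulrC divfK // addrC.
Qed.

(** The roots in [w] of [P (i 1 + e (x + i u) + w y)] start in the lower
    half-plane and cannot cross the real axis, where the imaginary part of the
    argument is [1 + e u]; so they miss [w = i b] when [e = 1]. *)
Lemma nonvanishing_extend u y b : cone y -> 0 <= b ->
  (forall e, 0 <= e <= 1 -> nonvanishing (one + e *: u)) ->
  nonvanishing (one + u + b *: y).
Proof.
move=> hy b0 hu x; apply/eqP => h.
pose F e w := ceval P (fun i =>
  iC + toC e * Complex (x ord0 i) (u ord0 i) + w * toC (y ord0 i)).
suff /(_ (Complex 0 b)) : forall w, F 1 w = 0 -> Im w < 0.
  rewrite /= ltNge b0 => H; suff : false by []; apply: H.
  rewrite -[RHS]h; apply: eq_ceval => i.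
  by rewrite rmorph1 mul1r mulrC [_ * Complex 0 b]complex_scale !mxE /=; simpc;
    rewrite [b * _]mulrC.
apply: (@half_plane_homotopy _ k (toC (peval P y)) F).
- by rewrite fmorph_eq0 gt_eqF // peval_cone_gt0.
- by move=> e; apply: ceval_factor; rewrite // gt_eqF // peval_cone_gt0.
- have [M [M0 _ FL]] := ceval_lipschitz (fun=> iC)
    (fun i => Complex (x ord0 i) (u ord0 i)) y P_homog.
  by exists M => // a b' w; exact: FL.
- move=> e w e01 Fw; apply/eqP => w_real.
  have := hu e e01 (e *: x + Re w *: y); rewrite -Fw /F => /eqP; apply.
  apply: eq_ceval => i; case: w w_real {Fw} => r s /= ->.
  by rewrite complex_scale !mxE /=; simpc.
- move=> w Fw; apply: (cone_lower_roots hy); rewrite -[RHS]Fw.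
  by apply: eq_ceval => i; rewrite rmorph0 mul0r addr0.
Qed.

Lemma nonvanishing_cone2 y y' a b : cone y -> cone y' -> 0 <= a -> 0 <= b ->
  nonvanishing (one + a *: y + b *: y').
Proof.
move=> hy hy' a0 b0.
have ray c : 0 <= c -> nonvanishing (one + c *: y).
  move=> c0; rewrite -[one]addr0; apply: nonvanishing_extend => // e _.
  by rewrite scaler0 addr0; exact: nonvanishing_one.
apply: nonvanishing_extend => // e /andP[e0 _].
by rewrite scalerA; apply: ray; exact: mulr_ge0.
Qed.

(** The shift by [t 1] adds [t] to every eigenvalue. *)
Lemma cone_shift y : cone y ->
  exists2 e, 0 < e & forall t, - e <= t -> cone (y + t *: one).
Proof.
move=> [l [hl lpos]].
have [e e0 el] : exists2 e, 0 < e & forall i, e < tnth l i.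
  exists (\big[Num.min/1]_(i < k) tnth l i / 2).
    by rewrite divr_gt0 // lt_bigmin.
  move=> i; have := bigmin_le 1 i (tnth l).
  by have := lpos i; lra.
exists e => // t te; exists [tuple tnth l i + t | i < k]; split.
  move=> s; rewrite [y + _]addrC addrA -scalerDl hl; congr (_ * _).
  by apply: eq_bigr => i _; rewrite tnth_mktuple; ring.
by move=> i; rewrite tnth_mktuple; have := el i; lra.
Qed.

(** The vector 1 needed by [nonvanishing_cone2] is borrowed from [y] and [y'],
    both of which stay in the cone when a small multiple of it is removed. *)
Lemma nonvanishing_conv y y' a b : cone y -> cone y' ->
  0 <= a -> 0 <= b -> a + b = 1 -> nonvanishing (a *: y + b *: y').
Proof.
move=> hy hy' a0 b0 ab.
have [e1 e1_gt0 he1] := cone_shift hy; have [e2 e2_gt0 he2] := cone_shift hy'.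
pose e := Num.min e1 e2.
have e0 : 0 < e by rewrite lt_min e1_gt0.
have ye : cone (y + (- e) *: one) by apply: he1; rewrite lerN2 ge_min lexx.
have y'e : cone (y' + (- e) *: one) by apply: he2; rewrite lerN2 ge_min lexx orbT.
rewrite (_ : _ + _ = e *: (one + (a / e) *: (y + (- e) *: one)
                                + (b / e) *: (y' + (- e) *: one))).
  apply: nonvanishingZ; first by rewrite gt_eqF.
  by apply: nonvanishing_cone2; rewrite ?divr_ge0 ?(ltW e0).
apply/rowP => i; rewrite !mxE; rewrite -(subrK a 1) -{1}ab.
have := gt_eqF e0 => /negbT e_neq0; field.
by [].
Qed.

Lemma eigenvalues_exist x : exists l : k.-tuple R, eigenvalues P one x l.
Proof.
have [|rs szrs rsE] := ceval_factor (fun i => toC (x ord0 i)) (y := one) P_homog.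
  by rewrite gt_eqF.
have rs_real z : z \in rs -> toC (Re z) = z.
  move=> zrs; have : Im z = 0.
    apply: (@line_root_real x); rewrite rsE (big_rem z) //=.
    by rewrite subrr mul0r mulr0.
  by case: z {zrs} => ? ? /= ->.
have szl : size [seq - Re z | z <- rs] == k by rewrite size_map szrs.
exists (Tuple szl) => t; apply: (@complexI R).
rewrite -ceval_real (@eq_ceval _ _ _ _
  (fun i => toC (x ord0 i) + toC t * toC (one ord0 i))) => [|i]; last first.
  by rewrite -rmorphM -rmorphD !mxE addrC.
rewrite rsE rmorphM; congr (_ * _).
rewrite -(big_tuple _ _ (Tuple szl) xpredT (fun s => t + s)) big_map rmorph_prod.
rewrite big_seq [RHS]big_seq; apply: eq_bigr => z zrs.
by rewrite -{1}(rs_real z zrs) -rmorphB.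
Qed.

(** An eigenvalue [l <= 0] of the combination would make [P] vanish at its shift
    by [- l >= 0], which is a convex combination of shifts in the cone. *)
Lemma cone_convex y y' a b : cone y -> cone y' ->
  0 <= a -> 0 <= b -> a + b = 1 -> cone (a *: y + b *: y').
Proof.
move=> hy hy' a0 b0 ab; have [l hl] := eigenvalues_exist (a *: y + b *: y').
exists l; split=> // i; rewrite ltNge; apply/negP => li.
have [e1 e1_gt0 he1] := cone_shift hy; have [e2 e2_gt0 he2] := cone_shift hy'.
have /nonvanishing_peval/eqP := nonvanishing_conv (he1 (- tnth l i) ltac:(lra))
  (he2 (- tnth l i) ltac:(lra)) a0 b0 ab.
apply; rewrite (_ : _ + _ = - tnth l i *: one + (a *: y + b *: y')).
  by rewrite hl (bigD1 i) //= addNr mul0r mulr0.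
by rewrite !scalerDr addrACA -scalerDl ab scale1r addrC.
Qed.

End HyperbolicityCone.

(** * Averaging a point with its image under an involution *)

Section EvenRealRooted.
Context {R : realType}.
Local Notation normc := ComplexField.Normc.normc.
Local Notation Re := complex.Re.
Local Notation Im := complex.Im.
Local Notation toC := (real_complex R).

(** By evenness [g s ^ 2 = g s * g (- s)] is a constant times the product of the
    [r ^ 2 - s ^ 2] over the roots [r], and all these factors are nonnegative
    and at least [r ^ 2 - 1]. *)
Lemma even_real_rooted_decreasing (g : {poly R}) (s : R) :
  (forall t, g.[- t] = g.[t]) ->
  (forall z : R[i], root (map_poly toC g) z -> Im z = 0 /\ 1 < `|Re z|) ->
  `|s| <= 1 -> g.[1] ^+ 2 <= g.[s] ^+ 2.
Proof.
move=> geven groots s1; have [rs grs] := closed_field_poly_normal (map_poly toC g).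
have rs_root z : z \in rs -> Im z = 0 /\ 1 < `|Re z|.
  move=> zrs; apply: groots; rewrite grs /root hornerZ horner_prod.
  by rewrite (big_rem z) //= hornerXsubC subrr mul0r mulr0.
set c := normc (lead_coef (map_poly toC g)).
have normr t : normc (toC t) = `|t| by rewrite /= expr0n /= addr0 sqrtr_sqr.
have gE t : `|g.[t]| = c * \prod_(z <- rs) `|t - Re z|.
  rewrite -normr -[toC _]horner_map grs hornerZ ComplexField.Normc.normcM.
  congr (_ * _).
  rewrite horner_prod; under eq_bigr => z _ do rewrite hornerXsubC.
  rewrite normc_prod big_seq [RHS]big_seq; apply: eq_bigr => z /rs_root[z_real _].
  by rewrite -normr rmorphB; case: z z_real => ? ? /= ->.
have g2E t : `|t| <= 1 -> g.[t] ^+ 2 = c ^+ 2 * \prod_(z <- rs) (Re z ^+ 2 - t ^+ 2).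
  move=> t1; rewrite -(real_normK (num_real _)) expr2 -{2}geven !gE mulrACA -expr2.
  congr (_ * _); rewrite -big_split /= big_seq [RHS]big_seq.
  apply: eq_bigr => z /rs_root[_ z1].
  rewrite -normrM (_ : _ * _ = Re z ^+ 2 - t ^+ 2); last by ring.
  rewrite ger0_norm // subr_ge0 -(real_normK (num_real t))
    -(real_normK (num_real (Re z))).
  by rewrite ler_sqr ?nnegrE // (le_trans t1) // ltW.
rewrite !g2E ?normr1 //; apply: ler_wpM2l; first exact: sqr_ge0.
rewrite big_seq [leRHS]big_seq; apply: ler_prod => z /rs_root[_ z1].
have z2 : 1 <= Re z ^+ 2.
  by rewrite -(real_normK (num_real (Re z))) expr_ge1 // ltW.
have s2 : s ^+ 2 <= 1 by rewrite -(real_normK (num_real s)) expr_le1.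
by rewrite expr1n; lra.
Qed.

End EvenRealRooted.

Section SymmetricHyperbolic.
Context {R : realType} {n k : nat} (P : mpoly n R).
Context (P_sym : symmetric_poly P) (P_hyp : hyperbolic k P (const_mx 1)).
Implicit Types (x y : 'rV[R]_n) (s : 'S_n) (a : R).

Local Notation one := (const_mx 1 : 'rV[R]_n).
Local Notation cone := (hyperbolicity_cone k P one).
Local Notation Re := complex.Re.
Local Notation Im := complex.Im.
Local Notation toC := (real_complex R).

Lemma cone_perm s y : cone y -> cone (col_perm s y).
Proof.
move=> [l [hl lpos]]; exists l; split=> // t; rewrite -hl -[RHS](P_sym s).
by congr (peval P _); apply/rowP => i; rewrite !mxE.
Qed.

(** The segment from [s y] to [y] is [t |-> m + t d] for [-1 <= t <= 1], and
    [s] reverses it, so [P] restricted to its line is even. *)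
Lemma averaging_increases s y a : (s * s = 1)%g -> cone y -> 0 <= a <= 1 ->
  let z := (1 - a) *: y + a *: col_perm s y in cone z /\ peval P y <= peval P z.
Proof.
move=> ss hy /andP[a0 a1] z.
have hy' := cone_perm s hy; set y' := col_perm s y in z hy' *.
have hz : cone z by apply: (cone_convex P_hyp hy hy'); rewrite ?subr_ge0 ?subrK.
split=> //.
pose m := 2^-1 *: y + 2^-1 *: y'; pose d := 2^-1 *: y - 2^-1 *: y'.
have mdE t : t *: d + m = (1 + t) / 2 *: y + (1 - t) / 2 *: y'.
  by apply/rowP => i; rewrite !mxE; field.
have m_nv : nonvanishing P m.
  by apply: (nonvanishing_conv P_hyp hy hy'); lra.
have md_cone t : `|t| <= 1 -> cone (t *: d + m).
  rewrite ler_norml => /andP[t0 t1]; rewrite mdE.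
  by apply: (cone_convex P_hyp hy hy'); lra.
pose g := line_poly P d m.
have gE t : g.[t] = peval P (t *: d + m) by rewrite horner_line_poly.
have geven t : g.[- t] = g.[t].
  rewrite !gE -(P_sym s (t *: d + m)); congr (peval P _); apply/rowP => i.
  by rewrite !mxE -[s (s i)]permM ss perm1; ring.
have P_homog : homogeneous k P by case: P_hyp.
have groots (r : R[i]) : root (map_poly toC g) r -> Im r = 0 /\ 1 < `|Re r|.
  rewrite /root horner_map_line_poly => /eqP gr.
  (* A nonreal zero [r] would give the zero [d + r^-1 m] of [P], whose imaginary
     part is a nonzero multiple of [m]. *)
  have r_real : Im r = 0.
    apply/eqP; apply: contraT => Imr.
    have r0 : r != 0 by apply: contraNneq Imr => ->.
    have q0 : Im r^-1 != 0.
      case: r Imr {gr r0} => p q /= q0.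
      rewrite oppr_eq0 mulf_neq0 // invr_neq0 // paddr_eq0 ?sqr_ge0 //.
      by rewrite !sqrf_eq0 (negbTE q0) andbF.
    have /negP[] := nonvanishingZ P_hyp q0 m_nv (d + Re r^-1 *: m).
    suff : r ^+ k * ceval P (fun i => Complex ((d + Re r^-1 *: m) ord0 i)
        ((Im r^-1 *: m) ord0 i)) == 0 by rewrite mulf_eq0 expf_eq0 (negbTE r0) andbF.
    rewrite -(cevalZ _ _ P_homog) -gr; apply/eqP; apply: eq_ceval => i.
    rewrite (_ : Complex _ _ = toC (d ord0 i) + toC (m ord0 i) * r^-1).
      by rewrite mulrDr mulrCA divff // mulr1 addrC.
    rewrite complex_scale /=; simpc; rewrite !mxE.
    by congr (Complex _ _); ring.
  split=> //; rewrite ltNge; apply/negP => r1.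
  have := peval_cone_gt0 P_hyp (md_cone _ r1); rewrite -gE.
  suff -> : g.[Re r] = 0 by rewrite ltxx.
  apply: (@complexI R); rewrite gE -ceval_real -[RHS]gr; apply: eq_ceval => i.
  case: (r) r_real => p q /= ->.
  by rewrite mulrC complex_scale !mxE /=; simpc; congr (Complex _ _); ring.
have a_norm : `|1 - 2 * a| <= 1 by rewrite ler_norml; lra.
have := even_real_rooted_decreasing geven groots a_norm; rewrite !gE.
have -> : 1 *: d + m = y by rewrite mdE; apply/rowP => i; rewrite !mxE; field.
have -> : (1 - 2 * a) *: d + m = z by rewrite mdE; apply/rowP => i; rewrite !mxE; field.
by rewrite ler_sqr // nnegrE ltW // (peval_cone_gt0 P_hyp).
Qed.

End SymmetricHyperbolic.

(** * Majorization by successive transfers *)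

Section RobinHood.
Context {R : realFieldType} {n : nat} (Q : 'rV[R]_n -> Prop).
Hypothesis Q_average : forall y (i j : 'I_n) a, 0 <= a <= 1 -> Q y ->
  Q ((1 - a) *: y + a *: col_perm (tperm i j) y).
Implicit Types x y : 'rV[R]_n.

Local Notation prefix_sum x l := (\sum_(i < n | (i < l)%N) x ord0 i).

(** Robin Hood's argument.  Let [k] be the first index where [y] falls below
    [x]; the prefix sums force some [j < k] where [y] exceeds [x].  Moving
    the smaller of the two discrepancies from [j] to [k] is an averaging of
    [y] with its transpose, as [x] is nonincreasing; it preserves the
    hypotheses and makes one more entry agree.  Only [x] has to be sorted, so
    [y] need not be rearranged between the steps. *)
Lemma transfers_reach x y :
  (forall i j : 'I_n, (i <= j)%N -> x ord0 j <= x ord0 i) ->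
  (forall l, prefix_sum x l <= prefix_sum y l) ->
  prefix_sum x n = prefix_sum y n ->
  Q y -> Q x.
Proof.
move=> x_desc.
have [N] := ubnP #|[pred i | y ord0 i != x ord0 i]|.
elim: N y => // N IH y Ncard xy_le xy_eq Qy.
pose d i := y ord0 i - x ord0 i.
have dle l : 0 <= \sum_(i < n | (i < l)%N) d i.
  by rewrite sumrB subr_ge0.
have deq : \sum_(i < n) d i = 0.
  apply/eqP; rewrite sumrB subr_eq0; apply/eqP/esym; move: xy_eq.
  by congr (_ = _); apply: eq_bigl => i; rewrite ltn_ord.
have [/existsP[k0 dk0]|no_neg] := boolP [exists i, d i < 0]; last first.
  suff -> : x = y by [].
  have d_ge0 i : true -> 0 <= d i.
    by move=> _; rewrite leNgt; apply: contra no_neg => di; apply/existsP; exists i.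
  apply/rowP => i; apply/esym/eqP; rewrite -subr_eq0; apply/eqP.
  exact: (psumr_eq0P d_ge0 deq).
case: (@arg_minnP _ k0 (fun i => d i < 0) (fun i => i : nat) dk0) => k dk k_min.
have before_k (i : 'I_n) : (i < k)%N -> 0 <= d i.
  by move=> ik; rewrite leNgt; apply: contraL ik => /k_min; rewrite -leqNgt.
have [j jk dj] : exists2 j : 'I_n, (j < k)%N & 0 < d j.
  suff /existsP[j /andP[jk dj]] : [exists j : 'I_n, (j < k)%N && (0 < d j)] by exists j.
  apply: contraT; rewrite negb_exists => /forallP no_pos.
  have := dle k.+1; rewrite (bigD1 k) //= big1 ?addr0; first by rewrite leNgt dk.
  move=> i /andP[]; rewrite ltnS leq_eqVlt => /predU1P[/val_inj ->|ik _];
    first by rewrite eqxx.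
  apply/le_anti; rewrite before_k // andbT leNgt; apply: contra (no_pos i) => di.
  by rewrite ik.
have jk_neq : k != j by rewrite -val_eqE /= gtn_eqF.
have xkj : x ord0 k <= x ord0 j by apply: x_desc; exact: ltnW.
pose e := Num.min (d j) (- d k).
have e0 : 0 < e by rewrite lt_min dj oppr_gt0.
have ej : e <= d j by rewrite ge_min lexx.
have ek : e <= - d k by rewrite ge_min lexx orbT.
have yjk : e <= y ord0 j - y ord0 k by rewrite /d in dj dk ej ek *; lra.
have yjk0 : 0 < y ord0 j - y ord0 k by lra.
pose a := e / (y ord0 j - y ord0 k).
have a01 : 0 <= a <= 1.
  by rewrite divr_ge0 ?(ltW e0) ?(ltW yjk0) //= ler_pdivrMr // mul1r.
pose y' := (1 - a) *: y + a *: col_perm (tperm j k) y.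
have y'E i : y' ord0 i = y ord0 i - e *+ (i == j) + e *+ (i == k).
  have ae : a * (y ord0 j - y ord0 k) = e by rewrite divfK // gt_eqF.
  rewrite !mxE; case: tpermP => [->|->|/eqP/negbTE-> /eqP/negbTE->].
  - by rewrite eqxx eq_sym (negbTE jk_neq) -ae /=; ring.
  - by rewrite eqxx (negbTE jk_neq) -ae /=; ring.
  - by rewrite !mulr0n; ring.
have sum_y' l : prefix_sum y' l = prefix_sum y l - e *+ (j < l)%N + e *+ (k < l)%N.
  have delta (h : 'I_n) : \sum_(i < n | (i < l)%N) e *+ (i == h) = e *+ (h < l)%N.
    rewrite big_mkcond (bigD1 h) //= eqxx big1 ?addr0; first by case: ifP.
    by move=> i /negbTE ->; case: ifP.
  under eq_bigr => i _ do rewrite y'E.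
  by rewrite big_split /= sumrB !delta.
apply: (IH y') => //; last exact: Q_average.
- move: Ncard; rewrite ltnS; apply: leq_trans; apply: proper_card; apply/properP; split.
    apply/fintype.subsetP => i; rewrite !inE y'E.
    case: (eqVneq i j) => [-> _|ij]; first by rewrite -subr_eq0 gt_eqF.
    case: (eqVneq i k) => [-> _|ik]; first by rewrite -subr_eq0 lt_eqF.
    by rewrite subr0 addr0.
  have [djk|dkj] := leP (d j) (- d k).
    exists j; rewrite inE; first by rewrite -subr_eq0 gt_eqF.
    rewrite y'E eqxx [j == k]eq_sym (negbTE jk_neq) /= negbK.
    by rewrite /e min_l // /d; apply/eqP; ring.
  exists k; rewrite inE; first by rewrite -subr_eq0 lt_eqF.
  rewrite y'E eqxx (negbTE jk_neq) /= negbK.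
  by rewrite /e min_r ?(ltW dkj) // /d; apply/eqP; ring.
(* Before [k] all discrepancies are nonnegative, so beyond [j] the prefix sums
   have room for the amount removed. *)
- move=> l; rewrite sum_y'; have [kl|lk] := ltnP k l.
    by rewrite (ltn_trans jk kl) subrK.
  have [jl|_] := ltnP j l; last by rewrite subr0 addr0.
  rewrite mulr0n addr0 mulr1n lerBrDr -lerBrDl -sumrB (bigD1 j) //= -/(d j).
  rewrite -[e]addr0 lerD //; apply: sumr_ge0 => i /andP[il _].
  by apply: before_k; exact: leq_trans lk.
- by rewrite sum_y' !ltn_ord subrK.
Qed.

End RobinHood.

Section Majorization.
Context {R : realType} {n : nat}.
Implicit Types x y : 'rV[R]_n.

Lemma sorted_rearrangement x : exists s : 'S_n,
  (forall i j : 'I_n, (i <= j)%N -> col_perm s x ord0 j <= col_perm s x ord0 i) /\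
  forall l, (l <= n)%N ->
    sum_largest x l = \sum_(i < n | (i < l)%N) col_perm s x ord0 i.
Proof.
pose t := [tuple x ord0 i | i < n].
have [s sE] : exists s : 'S_n,
    decreasing_rearrangement x = [tuple tnth t (s i) | i < n].
  by apply/tuple_permP; rewrite perm_sort -[X in perm_eq X _]/(val t) perm_refl.
have nthE (i : 'I_n) : nth 0 (decreasing_rearrangement x) i = col_perm s x ord0 i.
  by rewrite sE -tnth_nth tnth_mktuple tnth_mktuple !mxE.
have sz : size (decreasing_rearrangement x) = n by rewrite sE size_tuple.
exists s; split=> [i j ij|l ln].
  have desc : sorted (fun u v : R => v <= u) (decreasing_rearrangement x).
    by apply: sort_sorted => u v; exact: le_total.
  rewrite -!nthE; apply: (sorted_leq_nth _ _ 0 desc) => //.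
  - by move=> u v w h1 h2; exact: le_trans h1.
  - by rewrite inE sz.
  - by rewrite inE sz.
rewrite /sum_largest big_mkord (big_ord_widen n) //.
by apply: eq_bigr => i _; rewrite nthE.
Qed.

Lemma majorized_induction (Q : 'rV[R]_n -> Prop) :
  (forall y (s : 'S_n), Q y -> Q (col_perm s y)) ->
  (forall y (i j : 'I_n) a, 0 <= a <= 1 -> Q y ->
     Q ((1 - a) *: y + a *: col_perm (tperm i j) y)) ->
  forall x y, majorized x y -> Q y -> Q x.
Proof.
move=> Qperm Qavg x y [xy_lt xy_eq] Qy.
have [s [xs_desc xs_sum]] := sorted_rearrangement x.
have [s' [_ ys_sum]] := sorted_rearrangement y.
have -> : x = col_perm s^-1 (col_perm s x) by rewrite -col_permM mulVg col_perm1.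
apply: (Qperm); apply: (transfers_reach Qavg xs_desc _ _ (Qperm y s' Qy)).
- move=> l; have [ln|nl] := ltnP l n; last first.
    have all_lt z : \sum_(i < n | (i < l)%N) z ord0 i =
        \sum_(i < n | (i < n)%N) z ord0 i :> R.
      by apply: eq_bigl => i; rewrite ltn_ord (leq_trans (ltn_ord i)).
    by rewrite !all_lt -xs_sum // -ys_sum // xy_eq.
  case: l ln => [|l] ln; first by rewrite !big_pred0.
  by rewrite -xs_sum 1?ltnW // -ys_sum 1?ltnW // xy_lt.
- by rewrite -xs_sum // -ys_sum.
Qed.

End Majorization.

Unset Implicit Arguments.

Theorem theorem2p10 (R : realType) (n k : nat) (P : mpoly n R)
    (k_gt0 : (0 < k)%N)
    (P_sym : symmetric_poly P)
    (P_hyp : hyperbolic k P (const_mx 1)) :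
  (forall x y : 'rV[R]_n,
     hyperbolicity_cone k P (const_mx 1) y -> majorized x y ->
     hyperbolicity_cone k P (const_mx 1) x) /\
  schur_concave (hyperbolicity_cone k P (const_mx 1))
    (fun x => peval P x `^ (k%:R^-1)) /\
  schur_concave (hyperbolicity_cone k P (const_mx 1)) (peval P).
Proof.
have main (x y : 'rV[R]_n) : hyperbolicity_cone k P (const_mx 1) y ->
    majorized x y ->
    hyperbolicity_cone k P (const_mx 1) x /\ peval P y <= peval P x.
  move=> hy xy; pose Q z :=
    hyperbolicity_cone k P (const_mx 1) z /\ peval P y <= peval P z.
  apply: (@majorized_induction R n Q _ _ x y xy); last by split.
  - move=> z s [hz yz]; split; first exact: cone_perm.
    by rewrite P_sym.
  - move=> z i j a a01 [hz yz].
    have [hz' zz'] := averaging_increases P_sym P_hyp (tperm2 i j) hz a01.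
    by split=> //; exact: le_trans zz'.
split; first by move=> x y hy xy; have [] := main x y hy xy.
split=> x y hx hy xy; have [_ Pyx] := main x y hy xy => //.
apply: ge0_ler_powR => //; rewrite ?invr_ge0 ?nnegrE //; apply: ltW.
  exact: (peval_cone_gt0 P_hyp hy).
exact: (peval_cone_gt0 P_hyp hx).
Qed.
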